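(* Let $a,b,q,p$ be complex numbers with $a,b,q\neq 0$ and $|p|<1$, chosen such that non-removable singularities and poles are avoided in the expressions below (so that both sides make sense, values at removable singularities being understood by continuity). For all non-negative integers $n,m$, $$\sum_{k=0}^n W_{a,b;q,p}(k)\,[m+1]_{aq^{2k},\,bq^k;q,p}\, \Big( [k+1]_{a,b;q,p}[k+2]_{a,b;q,p}\cdots [k+m]_{a,b;q,p}\Big) =[n+1]_{a,b;q,p}[n+2]_{a,b;q,p}\cdots [n+m+1]_{a,b;q,p}.$$
   Context: For $|p|<1$ and complex $x\neq 0$, the modified Jacobi theta function is $\theta(x;p):=\prod_{j=0}^\infty (1-xp^j)(1-p^{j+1}/x)$, and $\theta(x_1,\dots,x_r;p):=\theta(x_1;p)\cdots\theta(x_r;p)$. (For $p=0$, $\theta(x;0)=1-x$.) The elliptic number is $$[z]_{a,b;q,p}:=\frac{\theta(q^z,aq^z,bq^2,a/b;p)}{\theta(q,aq,bq^{z+1},aq^{z-1}/b;p)}$$ and the elliptic weight is $$W_{a,b;q,p}(k):=\frac{\theta(aq^{2k+1},bq,bq^2,aq^{-1}/b,a/b;p)}{\theta(aq,bq^{k+1},bq^{k+2},aq^{k-1}/b,aq^k/b;p)}\,q^k.$$ When subscripts such as $aq^{2k},bq^{k}$ appear, they replace $a,b$ in these definitions. Empty products (e.g. $[k+1]_{a,b;q,p}\cdots[k+m]_{a,b;q,p}$ for $m=0$) equal $1$. *)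

(* Defs.v *)
(* MathComp with MathComp-Analysis; complex numbers are R[i] of real-closed. *)
From HB Require Import structures.
From mathcomp Require Import all_boot all_order all_algebra.
From mathcomp Require Import complex.
From mathcomp Require Import all_classical all_reals all_analysis.
Set Implicit Arguments.
Unset Strict Implicit.
Unset Printing Implicit Defensive.
Import Order.TTheory GRing.Theory Num.Theory.
Import numFieldNormedType.Exports.
Local Open Scope classical_set_scope.
Local Open Scope ring_scope.

(* Typing R[i] as a numClosedFieldType is what gives it the topology of its
   modulus. *)
Definition C (R : realType) : numClosedFieldType := R[i].

Section EllipticNumbers.
Variable R : realType.
Local Notation C := (C R).
Implicit Types (a b q p x : C) (z : int) (k n m : nat).

(* Meaningful for `|p| < 1 and x != 0; note p ^+ 0 = 1 also when p = 0. *)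
Definition theta p x : C :=
  lim ((\prod_(0 <= j < N) ((1 - x * p ^+ j) * (1 - p ^+ j.+1 / x)))
         @[N --> \oo]).

Definition thetas p (s : seq C) : C := \prod_(x <- s) theta p x.

Definition ell_num_den a b q p z : C :=
  thetas p [:: q; a * q; b * q ^ (z + 1); a * q ^ (z - 1) / b].

Definition ell_num a b q p z : C :=
  thetas p [:: q ^ z; a * q ^ z; b * q ^+ 2; a / b] / ell_num_den a b q p z.

Definition ell_weight_den a b q p k : C :=
  thetas p [:: a * q; b * q ^+ k.+1; b * q ^+ k.+2;
               a * q ^ (k%:Z - 1) / b; a * q ^+ k / b].

Definition ell_weight a b q p k : C :=
  thetas p [:: a * q ^+ (2 * k).+1; b * q; b * q ^+ 2; a * q^-1 / b; a / b]
    / ell_weight_den a b q p k * q ^+ k.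

Definition lhs p n m a b q : C :=
  \sum_(0 <= k < n.+1)
    ell_weight a b q p k
    * ell_num (a * q ^+ (2 * k)) (b * q ^+ k) q p m.+1%:Z
    * \prod_(1 <= j < m.+1) ell_num a b q p (k + j)%:Z.

Definition rhs p n m a b q : C :=
  \prod_(1 <= j < m.+2) ell_num a b q p (n + j)%:Z.

(* No denominator written in lhs, resp. rhs, vanishes. *)
Definition lhs_dom p n m a b q : Prop :=
  [/\ a != 0, b != 0, q != 0 &
   forall k, (k <= n)%N ->
   [/\ ell_weight_den a b q p k != 0,
       ell_num_den (a * q ^+ (2 * k)) (b * q ^+ k) q p m.+1%:Z != 0 &
       forall j, (1 <= j <= m)%N -> ell_num_den a b q p (k + j)%:Z != 0]].

Definition rhs_dom p n m a b q : Prop :=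
  [/\ a != 0, b != 0, q != 0 &
   forall j, (1 <= j <= m.+1)%N -> ell_num_den a b q p (n + j)%:Z != 0].

(* For an expression f in (a, b, q), literally defined on the set D: its limit
   at (a, b, q) along D.  The base p stays fixed. *)
Definition limit_filter (D : C -> C -> C -> Prop) (f : C -> C -> C -> C) a b q
    : set_system C :=
  f x.1.1 x.1.2 x.2
    @[x --> within [set x : C * C * C | D x.1.1 x.1.2 x.2] (nbhs (a, b, q))].

(* f is literally defined at (a, b, q), or has a removable singularity there. *)
Definition makes_sense (D : C -> C -> C -> Prop) (f : C -> C -> C -> C) a b q
    : Prop :=
  D a b q \/
  (closure [set x : C * C * C | D x.1.1 x.1.2 x.2] (a, b, q)
   /\ cvg (limit_filter D f a b q)).

(* The literal value where f is defined, the value by continuity elsewhere. *)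
Definition value (D : C -> C -> C -> Prop) (f : C -> C -> C -> C) a b q : C :=
  if `[< D a b q >] then f a b q else lim (limit_filter D f a b q).

End EllipticNumbers.

(* Main.v *)
(** With a = s ^ 2, the recursion [n] + W(n) [m+1]_(a q^2n, b q^n) = [n+m+1] is
    Weierstrass' addition formula for theta, so the sum telescopes wherever no
    denominator of the left-hand side vanishes; the denominators of the
    right-hand side all occur on the left. Removable singularities follow
    because theta is continuous away from 0.

    Weierstrass' formula: the finite Jacobi triple product (q-binomial theorem)
    expands the partial products of theta(xy) theta(x/y) as sums over Z x Z.
    Splitting Z x Z by the parity of k + l and letting the q-binomials tend to
    their limit (dominated convergence) shows that theta(xy) theta(x/y) is the
    limit of k x (B1(x) B0(y) - B0(x) B1(y)), where B0(z) and B1(z) are partial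
    sums of p^(j^2) z^(2j) and p^(j^2+j) z^(2j+1). The formula is then the Plücker
    relation between 2x2 minors. *)
From HB Require Import structures.
Require Import Defs.
From mathcomp Require Import all_boot all_order all_algebra ring zify.
From mathcomp Require Import complex.
From mathcomp Require Import all_classical all_reals all_analysis.
Set Implicit Arguments.
Unset Strict Implicit.
Unset Printing Implicit Defensive.
Import Order.TTheory GRing.Theory Num.Theory.
Import numFieldNormedType.Exports.
Local Open Scope classical_set_scope.
Local Open Scope ring_scope.

(** * The finite Jacobi triple product *)

(** The q-Pochhammer symbol (p; p)_n. *)
Definition qpoch (F : fieldType) (p : F) n : F := \prod_(j < n) (1 - p ^+ j.+1).

Lemma qpochS (F : fieldType) (p : F) n :
  qpoch p n.+1 = qpoch p n * (1 - p ^+ n.+1).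
Proof. by rewrite /qpoch big_ord_recr. Qed.

(** The Gaussian binomial coefficient for k <= n; beyond that, truncated subtraction gives
    [qpoch p n / qpoch p k] instead of 0. *)
Definition qbin (F : fieldType) (p : F) n k : F :=
  qpoch p n / (qpoch p k * qpoch p (n - k)).

(** Induction on n by the Pascal rule that expresses [qbin p n.+1 k.+1] as [qbin p n k.+1] plus
    p^(n-k) times [qbin p n k]. The hypothesis keeps every [qpoch] invertible. *)
Lemma gauss_binomial (F : fieldType) (p z : F) n
    (hp : forall j, p ^+ j.+1 != 1) :
  \prod_(j < n) (1 + z * p ^+ j)
  = \sum_(k < n.+1) p ^+ 'C(k, 2) * z ^+ k * qbin p n k.
Proof.
have h1 j : 1 - p ^+ j.+1 != 0 by rewrite subr_eq0 eq_sym.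
have q0 j : qpoch p j != 0 by apply/prodf_neq0 => i _.
have qb0 j : qbin p j 0 = 1.
  by rewrite /qbin subn0 {2}/qpoch big_ord0 mul1r divff.
have qbn j : qbin p j j = 1.
  by rewrite /qbin subnn {3}/qpoch big_ord0 mulr1 divff.
elim: n => [|n IH]; first by rewrite big_ord0 big_ord1 qb0 !expr0 !mulr1.
rewrite big_ord_recr /= IH mulrDr mulr1.
(* The extreme terms k = 0 and k = n + 1 are split off; the Pascal rule is applied to those in
   between. *)
rewrite [in X in X + _ = _]big_ord_recl [in RHS]big_ord_recl !qb0 -addrA; congr (_ + _).
rewrite [in RHS]big_ord_recr /= mulr_suml [X in _ + X]big_ord_recr /=.
rewrite addrA -big_split /=; congr (_ + _); last first.
  rewrite !qbn !mulr1 /bump /= add1n binS bin1 exprD exprS; ring.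
apply: eq_bigr => k _; rewrite /bump /= !add1n binS bin1 !exprD.
have lekn := ltn_ord k; rewrite /qbin subSS -(subnSK lekn) !qpochS (subnSK lekn).
have -> : p ^+ n.+1 = p ^+ k.+1 * p ^+ (n - k) by rewrite -exprD; congr (_ ^+ _); lia.
have -> : p ^+ n = p ^+ k * p ^+ (n - k) by rewrite -exprD; congr (_ ^+ _); lia.
have := h1 (n - k.+1)%N; rewrite subnSK // => hnk.
rewrite (exprS z); have := h1 k; move: (p ^+ k.+1) (exprS p k) => u -> hk.
by field; rewrite !q0 hnk hk.
Qed.

(** The number l (l - 1) / 2, which is never negative, as a natural exponent. *)
Definition tri (l : int) : nat :=
  match l with Posz n => 'C(n, 2) | Negz n => 'C(n.+2, 2) end.

Lemma tri_double (l : int) : 2 * (tri l)%:Z = l * (l - 1).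
Proof.
have H n : 2 * 'C(n.+1, 2)%:Z = n%:Z * (n%:Z + 1).
  elim: n => [|n IH]; first by rewrite bin_small.
  by rewrite binS bin1; lia.
case: l => [[|n]|n]; rewrite /tri; first by rewrite bin_small.
  by have := H n; lia.
by have := H n.+1; lia.
Qed.

Definition zint N : seq int := [seq (k%:Z - N%:Z)%R | k <- iota 0 (2 * N).+1].

Lemma zint_uniq N : uniq (zint N).
Proof. by rewrite map_inj_uniq ?iota_uniq // => i j /addIr []. Qed.

Lemma mem_zint N (l : int) : (l \in zint N) = (absz l <= N)%N.
Proof.
apply/mapP/idP => [[k] | le_lN].
  by rewrite mem_iota => /andP[_ ?] ->; lia.
exists (absz (l + N%:Z)); last by lia.
by rewrite mem_iota; lia.
Qed.

(** General term of the Jacobi triple product series. *)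
Definition jterm (F : fieldType) (p x : F) (l : int) : F :=
  p ^+ tri l * (- x) ^ l.

(** Meaningful for |l| <= N. Outside that range the value is arbitrary, but bounds and limits still
    hold for it. *)
Definition jcoef (F : fieldType) (p : F) N (l : int) : F :=
  qbin p (2 * N) (absz (N%:Z + l)).

Definition theta_part (F : fieldType) (p x : F) N : F :=
  \prod_(0 <= j < N) ((1 - x * p ^+ j) * (1 - p ^+ j.+1 / x)).

(** Taking -p^(j+1)/x out of each factor 1 - p^(j+1)/x turns the partial product into a monomial
    times a product of 2N factors in geometric progression. The q-binomial theorem at z = -x/p^N
    applies, with k = N + l. *)
Lemma finite_triple_product (F : fieldType) (p x : F) N
    (p0 : p != 0) (hp : forall j, p ^+ j.+1 != 1) (x0 : x != 0) :
  theta_part p x N = \sum_(l <- zint N) jterm p x l * jcoef p N l.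
Proof.
have -> : theta_part p x N
    = (\prod_(j < N) (- p ^+ j.+1 / x)) *
      \prod_(j < 2 * N) (1 + (- x / p ^+ N) * p ^+ j).
  have pN j : p ^+ j != 0 by rewrite expf_neq0.
  have -> : \prod_(j < 2 * N) (1 + - x / p ^+ N * p ^+ j)
      = \prod_(j < N) (1 - x / p ^+ j.+1) * \prod_(j < N) (1 - x * p ^+ j).
    rewrite mul2n -addnn big_split_ord /=; congr (_ * _).
      (* Read backwards, the lower half carries the exponents -1, ..., -N. *)
      rewrite (reindex_inj rev_ord_inj) /=; apply: eq_bigr => i _.
      have -> : p ^+ N = p ^+ (N - i.+1) * p ^+ i.+1.
        by rewrite -exprD subnK.
      by field; rewrite ?pN ?p0.
    by apply: eq_bigr => i _; rewrite exprD; field.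
  rewrite /theta_part big_mkord mulrA -!big_split /=; apply: eq_bigr => i _.
  by field; rewrite ?pN ?p0 ?x0.
rewrite gauss_binomial // /zint big_map mulr_sumr.
rewrite -[iota _ _]/(index_iota 0 (2 * N).+1) big_mkord.
apply: eq_bigr => k _.
rewrite /jcoef; have -> : absz (N%:Z + (k%:Z - N%:Z)) = k by lia.
rewrite mulrA; congr (_ * _).
have -> : \prod_(j < N) (- p ^+ j.+1 / x) = p ^+ 'C(N.+1, 2) * (- x) ^- N.
  elim: (N) => [|M IH]; first by rewrite big_ord0 bin_small // !expr0 invr1 mulr1.
  rewrite big_ord_recr /= IH [in RHS]binS bin1 exprD !exprS.
  have xM : (- x) ^+ M != 0 by rewrite expf_neq0 ?oppr_eq0.
  by field; rewrite xM oppr_eq0 x0.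
have xN j : (- x) ^+ j != 0 by rewrite expf_neq0 ?oppr_eq0.
have pN j : p ^+ j != 0 by rewrite expf_neq0.
(* Completing the square with l = k - N: the powers of p from the monomial, from the q-binomial
   theorem and from z^k combine to [tri l]. *)
have tE : ('C(N.+1, 2) + 'C(k, 2) = N * k + tri (k%:Z - N%:Z))%N.
  have := tri_double (k%:Z - N%:Z); have := tri_double N.+1%:Z.
  have := tri_double k%:Z; rewrite /tri -/(tri (k%:Z - N%:Z)).
  move: (tri _) (binomial k 2) (binomial N.+1 2) => A B D; lia.
rewrite /jterm expfzDr ?oppr_eq0 // exprnN -exprnP.
have -> : p ^+ tri (k%:Z - N%:Z) = p ^+ 'C(N.+1, 2) * p ^+ 'C(k, 2) / p ^+ (N * k).
  by rewrite -exprD tE exprD mulrAC divff // mul1r.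
rewrite exprMn exprVn -exprM.
by field; rewrite pN.
Qed.

(** With x = e^(iz) and nome p, these are partial sums of Jacobi's theta_3; those of [bser1] belong
    to p^(-1/4) theta_2. *)
Definition bser0 (F : fieldType) (p x : F) N : F :=
  \sum_(j <- zint N) p ^ (j * j) * x ^ (2 * j).

Definition bser1 (F : fieldType) (p x : F) N : F :=
  \sum_(j <- zint N) p ^ (j * j + j) * x ^ (2 * j + 1).

(** The first list has k + l even, the second k + l odd. Within each, k + l depends on i alone and k
    - l on j alone, so that a double sum can factor. *)
Definition zdiamond N : seq (int * int) :=
  [seq (i + j + 1, i + 1 - j) | i <- zint N, j <- zint N] ++
  [seq (i + j + 1, i - j) | i <- zint N, j <- zint N].

Lemma zdiamond_uniq N : uniq (zdiamond N).
Proof.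
rewrite cat_uniq; apply/and3P; split.
- apply: allpairs_uniq (zint_uniq N) (zint_uniq N) _.
  by move=> [i j] [i' j'] _ _ /= [h1 h2]; congr pair; lia.
- apply/hasPn => _ /allpairsP[[i j] [_ _ ->]].
  by apply/negP => /allpairsP[[i' j'] [_ _ []]] /=; lia.
- apply: allpairs_uniq (zint_uniq N) (zint_uniq N) _.
  by move=> [i j] [i' j'] _ _ /= [h1 h2]; congr pair; lia.
Qed.

(** Solving for i and j according to the parity of k + l; the strict bounds leave room for the
    shifts by one. *)
Lemma mem_zdiamond N (k l : int) :
  (absz k < N)%N -> (absz l < N)%N -> (k, l) \in zdiamond N.
Proof.
move=> hk hl; rewrite mem_cat; have [klodd|kleven] := boolP (odd (absz (k + l))).
  apply/orP; right; apply/allpairsP.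
  exists (((k + l - 1) %/ 2)%Z, ((k - l - 1) %/ 2)%Z) => /=.
  by rewrite !mem_zint; split; [lia | lia | congr pair; lia].
apply/orP; left; apply/allpairsP.
exists (((k + l) %/ 2)%Z - 1, ((k - l) %/ 2)%Z) => /=.
by rewrite !mem_zint; split; [lia | lia | congr pair; lia].
Qed.

(** Each product of terms is (-1)^(k+l) p^(tri k + tri l) x^(k+l) y^(k-l). In the coordinates i and
    j it separates; the even pairs give the first product of the minor, the odd pairs the second
    with a minus sign. *)
Lemma sum_zdiamond (F : fieldType) (p x y : F) N
    (p0 : p != 0) (x0 : x != 0) (y0 : y != 0) :
  \sum_(kl <- zdiamond N) jterm p (x * y) kl.1 * jterm p (x / y) kl.2
  = x * (bser1 p x N * bser0 p y N - bser0 p x N * bser1 p y N).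
Proof.
have triE k l (e : int) : 2 * e = k * (k - 1) + l * (l - 1) ->
    p ^+ tri k * p ^+ tri l = p ^ e.
  move=> he; rewrite !exprnP -expfzDr //; congr (_ ^ _).
  by have := tri_double k; have := tri_double l; lia.
have zE k l : (- (x * y)) ^ k * (- (x / y)) ^ l
    = (- 1) ^ (k + l) * x ^ (k + l) * y ^ (k - l).
  rewrite -[- (x * y)]mulN1r -[- (x / y)]mulN1r.
  rewrite !expfzMl ?invr_eq0 // !expfzDr ?oppr_eq0 ?oner_eq0 //.
  by rewrite -exprz_inv; ring.
have sgnE k : (- 1 : F) ^ (2 * k) = 1.
  by rewrite -exprz_exp -exprnP sqrrN expr1n exp1rz.
rewrite big_cat !big_allpairs_dep /= /bser0 /bser1 mulrBr; congr (_ + _).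
  rewrite big_distrlr /= mulr_sumr; apply: eq_bigr => i _.
  rewrite mulr_sumr; apply: eq_bigr => j _; rewrite /jterm.
  rewrite mulrACA zE (triE _ _ (i * i + i + j * j)); last by ring.
  have -> : i + j + 1 + (i + 1 - j) = 2 * (i + 1) by ring.
  have -> : i + j + 1 - (i + 1 - j) = 2 * j by ring.
  rewrite sgnE.
  have -> : 2 * (i + 1) = 1 + (2 * i + 1) by ring.
  rewrite mul1r [x ^ (1 + _)]expfzDr // expr1z expfzDr //.
  by ring.
rewrite -mulrN big_distrlr /= -sumrN mulr_sumr; apply: eq_bigr => i _.
rewrite -sumrN mulr_sumr; apply: eq_bigr => j _; rewrite /jterm.
rewrite mulrACA zE (triE _ _ (i * i + (j * j + j))); last by ring.
have -> : i + j + 1 + (i - j) = 2 * i + 1 by ring.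
have -> : i + j + 1 - (i - j) = 2 * j + 1 by ring.
rewrite [(- 1) ^ _]expfzDr ?oppr_eq0 ?oner_eq0 // sgnE expr1z.
by rewrite [p ^ _]expfzDr // [x ^ _]expfzDr // expr1z; ring.
Qed.

(** * Infinite products over the complex numbers *)

(** The codomain is typed as [C R] so that its norm and topology apply. *)
Definition rc (R : realType) (x : R) : C R := (x%:C)%C.

(** Nonnegative elements of [C R] are real in its partial order; bounds stated there are moved to R
    this way. *)
Lemma ge0_rc (R : realType) (x : C R) : 0 <= x -> x = rc (complex.Re x).
Proof. by move=> x0; rewrite /rc [RHS]RRe_real // ger0_real. Qed.

Lemma rc_le (R : realType) (x y : R) : (rc x <= rc y) = (x <= y).
Proof. exact: lecR. Qed.

Lemma rc_lt (R : realType) (x y : R) : (rc x < rc y) = (x < y).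
Proof. exact: ltcR. Qed.

Lemma rc_norm (R : realType) (x : R) : `|rc x| = rc `|x|.
Proof. by rewrite /rc normc_def /= expr0n addr0 sqrtr_sqr. Qed.

HB.instance Definition _ (R : realType) :=
  GRing.RMorphism.copy (@rc R) (real_complex R).

Lemma norm_Re_le (R : realType) (x : C R) : rc `|complex.Re x| <= `|x|.
Proof. exact: normc_ge_Re. Qed.

Lemma norm_Im_le (R : realType) (x : C R) : rc `|complex.Im x| <= `|x|.
Proof.
rewrite normc_def lecR -sqrtr_sqr ler_sqrt ?addr_ge0 ?sqr_ge0 //.
by rewrite lerDr sqr_ge0.
Qed.

Lemma cvg_rc (R : realType) (u : nat -> R) (l : R) :
  u @ \oo --> l -> (fun n => rc (u n)) @ \oo --> rc l.
Proof.
move=> ul; apply/cvgrPdist_lt => e e0.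
have e0' := e0; rewrite (ge0_rc (ltW e0)) -[0]/(rc 0) rc_lt in e0'.
move/cvgrPdist_lt: ul => /(_ _ e0'); apply: filterS => n.
by rewrite -rmorphB rc_norm (ge0_rc (ltW e0)) rc_lt.
Qed.

Lemma geometric_sum_le (K : numFieldType) (r : K) N :
  0 <= r -> r < 1 -> \sum_(j < N) r ^+ j <= (1 - r)^-1.
Proof.
move=> r0 r1; have r1' : 0 < 1 - r by rewrite subr_gt0.
rewrite -[leRHS]mul1r ler_pdivlMr // mulrC -opprB mulNr -subrX1 opprB.
by rewrite lerBlDr lerDl exprn_ge0.
Qed.
(** Uses 1 + t <= exp t factor by factor. *)
Lemma expR_prod (R : realType) (k r : R) N : 0 <= k -> 0 <= r -> r < 1 ->
  \prod_(j < N) (1 + k * r ^+ j) <= expR (k / (1 - r)).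
Proof.
move=> k0 r0 r1; apply: (@le_trans _ _ (\prod_(j < N) expR (k * r ^+ j))).
  by apply: ler_prod => j _; rewrite expR_ge1Dx addr_ge0 // mulr_ge0 ?exprn_ge0.
rewrite -expR_sum ler_expR -mulr_sumr ler_wpM2l //; exact: geometric_sum_le.
Qed.

Lemma prod_geometric_bounded (R : realType) (K r : C R) :
  0 <= K -> 0 <= r -> r < 1 ->
  exists2 W : C R, 0 < W & forall N, \prod_(j < N) (1 + K * r ^+ j) <= W.
Proof.
move=> K0 r0 r1; exists (rc (expR (complex.Re K / (1 - complex.Re r)))).
  by rewrite -[0]/(rc 0) rc_lt expR_gt0.
move=> N; rewrite {1}(ge0_rc K0) {1}(ge0_rc r0).
under eq_bigr => j _ do rewrite -rmorphXn -rmorphM -(rmorph1 (@rc R)) -rmorphD.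
rewrite -rmorph_prod rc_le expR_prod //.
- by rewrite -rc_le -ge0_rc.
- by rewrite -rc_le -ge0_rc.
- by rewrite -rc_lt -ge0_rc.
Qed.

Lemma cvg_geometric_increments_real (R : realType) (u : nat -> R) (k r : R) :
  0 <= r -> r < 1 -> (forall n, `|u n.+1 - u n| <= k * r ^+ n) -> cvgn u.
Proof.
move=> r0 r1 hu.
have k0 : 0 <= k by have := hu 0%N; rewrite expr0 mulr1; exact: le_trans.
have -> : u = (fun n => u 0%N + series (telescope u) n).
  by apply/funext => n; exact: eq_sum_telescope.
apply: is_cvgD; first exact: is_cvg_cst.
apply: normed_cvg.
apply: (@series_le_cvg _ _ (geometric k r)) => [n|n|n|].
- exact: normr_ge0.
- by rewrite /= mulr_ge0 ?exprn_ge0.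
- exact: hu.
- by apply: is_cvg_geometric_series; rewrite ger0_norm.
Qed.

(** Real and imaginary parts have increments below the same geometric bound, so each converges by
    the real case. *)
Lemma cvg_geometric_increments (R : realType) (u : nat -> C R) (k r : C R) :
  0 <= r -> r < 1 -> (forall n, `|u n.+1 - u n| <= k * r ^+ n) -> cvgn u.
Proof.
move=> r0 r1 hu.
have k0 : 0 <= k by have := hu 0%N; rewrite expr0 mulr1; exact: le_trans.
pose s := complex.Re r; pose l := complex.Re k.
have s0 : 0 <= s by rewrite -rc_le -ge0_rc.
have s1 : s < 1 by rewrite -rc_lt -ge0_rc.
have bnd (f : R) n : rc f <= `|u n.+1 - u n| -> f <= l * s ^+ n.
  move=> h; rewrite -rc_le rmorphM rmorphXn /= /l /s -!ge0_rc //.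
  exact: le_trans h (hu n).
have cRe : cvgn (fun n => complex.Re (u n)).
  apply: (@cvg_geometric_increments_real _ _ l s) => // n; apply: bnd.
  have := norm_Re_le (u n.+1 - u n).
  by case: (u n.+1) (u n) => [? ?] [? ?].
have cIm : cvgn (fun n => complex.Im (u n)).
  apply: (@cvg_geometric_increments_real _ _ l s) => // n; apply: bnd.
  have := norm_Im_le (u n.+1 - u n).
  by case: (u n.+1) (u n) => [? ?] [? ?].
have -> : u = (fun n => rc (complex.Re (u n)) + ('i%C : C R) * rc (complex.Im (u n))).
  by apply/funext => n; exact: complexE.
apply: is_cvgD; first by apply/cvg_ex; eexists; apply: cvg_rc; exact: cRe.
apply: is_cvgM; first exact: is_cvg_cst.
by apply/cvg_ex; eexists; apply: cvg_rc; exact: cIm.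
Qed.

Lemma prod1D_norm_le (K : numFieldType) (a : nat -> K) (k r : K) N :
  (forall j, `|a j| <= k * r ^+ j) ->
  `|\prod_(j < N) (1 + a j)| <= \prod_(j < N) (1 + k * r ^+ j).
Proof.
move=> ha; rewrite normr_prod; apply: ler_prod => j _; rewrite normr_ge0 /=.
by rewrite (le_trans (ler_normD _ _)) // normr1 lerD2l.
Qed.

(** Induction on N with A (1 + a) - B (1 + b) = (A - B) (1 + a) + B (a - b). Once product and sum
    are bounded, the estimate is uniform in N. *)
Lemma prod1D_lipschitz (K : numFieldType) (a b : nat -> K) (k d r : K) N :
  0 <= k -> 0 <= r ->
  (forall j, `|a j| <= k * r ^+ j) -> (forall j, `|b j| <= k * r ^+ j) ->
  (forall j, `|a j - b j| <= d * r ^+ j) ->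
  `|\prod_(j < N) (1 + a j) - \prod_(j < N) (1 + b j)|
  <= d * \prod_(j < N) (1 + k * r ^+ j) * \sum_(j < N) r ^+ j.
Proof.
move=> k0 r0 ha hb hab.
have d0 : 0 <= d by have := hab 0%N; rewrite expr0 mulr1; exact: le_trans.
elim: N => [|N IH]; first by rewrite !big_ord0 subrr normr0 mulr0.
rewrite !big_ord_recr /=.
set A := \prod_(j < N) (1 + a j) in IH *; set B := \prod_(j < N) (1 + b j) in IH *.
set W := \prod_(j < N) _ in IH *; set S := \sum_(j < N) _ in IH *.
have krN : 0 <= k * r ^+ N by rewrite mulr_ge0 ?exprn_ge0.
have W0 : 0 <= W by apply: prodr_ge0 => j _; rewrite addr_ge0 ?mulr_ge0 ?exprn_ge0.
have -> : A * (1 + a N) - B * (1 + b N) = (A - B) * (1 + a N) + B * (a N - b N).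
  by ring.
rewrite (le_trans (ler_normD _ _)) // !normrM.
have -> : d * (W * (1 + k * r ^+ N)) * (S + r ^+ N)
  = d * W * S * (1 + k * r ^+ N) + W * (1 + k * r ^+ N) * (d * r ^+ N) by ring.
apply: lerD.
  by apply: ler_pM => //; rewrite (le_trans (ler_normD _ _)) // normr1 lerD2l.
apply: ler_pM => //; apply: le_trans (prod1D_norm_le N hb) _.
by rewrite ler_peMr // lerDl.
Qed.

Lemma prod1D_cvg (R : realType) (a : nat -> C R) (k r : C R) :
  0 <= k -> 0 <= r -> r < 1 -> (forall j, `|a j| <= k * r ^+ j) ->
  cvgn (fun N => \prod_(j < N) (1 + a j)).
Proof.
move=> k0 r0 r1 ha; have [W W0 hW] := prod_geometric_bounded k0 r0 r1.
apply: (@cvg_geometric_increments _ _ (W * k) r) => // n.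
rewrite big_ord_recr /= mulrDr mulr1 addrAC subrr add0r normrM -mulrA.
by apply: ler_pM => //; apply: le_trans (prod1D_norm_le n ha) (hW n).
Qed.

(** * Convergence and continuity of theta *)

Definition theta_fac (F : fieldType) (p x : F) (j : nat) : F :=
  (1 - x * p ^+ j) * (1 - p ^+ j.+1 / x) - 1.

Lemma theta_partE (F : fieldType) (p x : F) N :
  theta_part p x N = \prod_(j < N) (1 + theta_fac p x j).
Proof.
rewrite /theta_part big_mkord; apply: eq_bigr => j _.
by rewrite /theta_fac; ring.
Qed.

(** Exhibits the geometric decay p^j on which convergence and continuity rest. *)
Lemma theta_facE (F : fieldType) (p x : F) j : x != 0 ->
  theta_fac p x j = - (x + p / x - p ^+ j.+1) * p ^+ j.
Proof. by move=> x0; rewrite /theta_fac exprS; field. Qed.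

Lemma theta_fac_norm_le (K : numFieldType) (p x : K) j : `|p| <= 1 -> x != 0 ->
  `|theta_fac p x j| <= (`|x| + `|x^-1| + 1) * `|p| ^+ j.
Proof.
move=> p1 x0; rewrite theta_facE // normrM normrN normrX ler_wpM2r ?exprn_ge0 //.
rewrite (le_trans (ler_normB _ _)) // lerD //; last first.
  by rewrite normrX exprn_ile1.
rewrite (le_trans (ler_normD _ _)) // lerD2l normrM ler_piMl //.
Qed.

Lemma theta_fac_sub_norm_le (K : numFieldType) (p x y : K) j :
  `|p| <= 1 -> x != 0 -> y != 0 ->
  `|theta_fac p x j - theta_fac p y j| <= (`|x - y| + `|x^-1 - y^-1|) * `|p| ^+ j.
Proof.
move=> p1 x0 y0; rewrite !theta_facE //.
have -> : - (x + p / x - p ^+ j.+1) * p ^+ j - - (y + p / y - p ^+ j.+1) * p ^+ j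
  = - ((x - y) + p * (x^-1 - y^-1)) * p ^+ j by ring.
rewrite normrM normrN normrX ler_wpM2r ?exprn_ge0 //.
by rewrite (le_trans (ler_normD _ _)) // lerD2l normrM ler_piMl.
Qed.

Lemma theta_part_cvg (R : realType) (p x : C R) : `|p| < 1 -> x != 0 ->
  theta_part p x @ \oo --> theta p x.
Proof.
move=> p1 x0; rewrite /theta.
suff : cvgn (theta_part p x) by [].
have -> : theta_part p x = (fun N => \prod_(j < N) (1 + theta_fac p x j)).
  by apply/funext => N; exact: theta_partE.
apply: (@prod1D_cvg _ _ (`|x| + `|x^-1| + 1) `|p|) => // j.
by apply: theta_fac_norm_le => //; exact: ltW.
Qed.

Lemma cvg_norm_le (K : numFieldType) (u : nat -> K) (l M : K) :
  u @ \oo --> l -> (forall n, `|u n| <= M) -> `|l| <= M.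
Proof.
move=> ul uM; have M0 : 0 <= M := le_trans (normr_ge0 _) (uM 0%N).
rewrite real_leNgt ?ger0_real //; apply/negP => lM.
have e0 : 0 < `|l| - M by rewrite subr_gt0.
move/cvgrPdist_lt : ul => /(_ _ e0)[n _ /(_ n (leqnn n))] /=.
rewrite ltrBrDr => h.
have : `|l| <= `|l - u n| + M.
  by rewrite -{1}(subrK (u n) l) (le_trans (ler_normD _ _)) // lerD2l.
by move=> /le_lt_trans /(_ h); rewrite ltxx.
Qed.

Lemma dist_inv_cvg0 (K : numFieldType) (x : K) : x != 0 ->
  (fun y : K => `|x - y| + `|x^-1 - y^-1|) @ x --> (0 : K).
Proof.
move=> x0; have : (fun y : K => `|x - y| + `|x^-1 - y^-1|) @ x
    --> (`|x - x| + `|x^-1 - x^-1| : K).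
  have h1 : (fun y : K => x - y) @ x --> x - x.
    exact: cvgB (cvg_cst _) cvg_id.
  have h2 : (fun y : K => x^-1 - y^-1) @ x --> x^-1 - x^-1.
    exact: cvgB (cvg_cst _) (inv_continuous x0).
  exact: cvgD (cvg_norm h1) (cvg_norm h2).
by rewrite !subrr normr0 addr0.
Qed.

(** Shaped for theta, where d measures the change of both y and 1/y and the estimate is available
    only for d y <= 1. *)
Lemma continuous_of_modulus (K : numFieldType) (f d : K -> K) (x B : K) :
  x != 0 -> 0 < B -> d @ x --> (0 : K) ->
  (forall y, y != 0 -> d y <= 1 -> `|f x - f y| <= d y * B) ->
  (forall y, 0 <= d y) -> {for x, continuous f}.
Proof.
move=> x0 B0 dc lip d0.
apply/(@cvgrPdist_le _ _ _ _ (nbhs_filter x)) => e e0.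
near=> y.
have dy : `|0 - d y| <= 1.
  near: y; move/cvgrPdist_le : dc; apply; exact: ltr01.
have dy' : `|0 - d y| <= e / B.
  near: y; move/cvgrPdist_le : dc; apply; exact: divr_gt0.
have dE : `|0 - d y| = d y by rewrite sub0r normrN ger0_norm .
rewrite dE in dy dy'.
have y0 : y != 0 by near: y; exact: (@cvgr_neq0 _ _ _ _ (nbhs_filter x) id x cvg_id x0).
by rewrite (le_trans (lip y y0 dy)) // -ler_pdivlMr.
Unshelve. all: by end_near.
Qed.

(** The partial products satisfy a Lipschitz estimate in d y with a constant independent of N, and
    it survives the limit. *)
Lemma theta_continuous (R : realType) (p x : C R) : `|p| < 1 -> x != 0 ->
  {for x, continuous (theta p)}.
Proof.
(* The last + 1 makes k a bound for |y| + |1/y| + 1 at every y with d y <= 1. *)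
move=> p1 x0; pose k : C R := `|x| + `|x^-1| + 1 + 1.
have k0 : 0 <= k by rewrite /k !addr_ge0.
have [W W0 hW] := prod_geometric_bounded k0 (normr_ge0 p) p1.
pose d (y : C R) : C R := `|x - y| + `|x^-1 - y^-1|.
have lip y : y != 0 -> d y <= 1 ->
    `|theta p x - theta p y| <= d y * (W * (1 - `|p|)^-1).
  move=> y0 dy.
  have p1' := ltW p1.
  have c : (fun N => theta_part p x N - theta_part p y N) @ \oo
           --> theta p x - theta p y.
    by apply: cvgB; exact: theta_part_cvg.
  apply: (cvg_norm_le c) => N; rewrite !theta_partE.
  apply: (le_trans (@prod1D_lipschitz _ (theta_fac p x) (theta_fac p y)
    k (d y) `|p| N k0 (normr_ge0 p) _ _ _)) => [j|j|j|].
  - apply: le_trans (theta_fac_norm_le _ p1' x0) _.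
    by rewrite ler_wpM2r ?exprn_ge0 // lerDl.
  - apply: le_trans (theta_fac_norm_le _ p1' y0) _.
    rewrite ler_wpM2r ?exprn_ge0 //.
    have hy : `|y| <= `|x| + `|x - y|.
      by rewrite -{1}(subKr x y) (le_trans (ler_normB _ _)).
    have hyV : `|y^-1| <= `|x^-1| + `|x^-1 - y^-1|.
      by rewrite -{1}(subKr x^-1 y^-1) (le_trans (ler_normB _ _)).
    apply: le_trans (lerD (lerD hy hyV) (lexx 1)) _.
    have -> : `|x| + `|x - y| + (`|x^-1| + `|x^-1 - y^-1|) + 1
      = `|x| + `|x^-1| + 1 + d y by rewrite /d; ring.
    by rewrite lerD2l.
  - exact: theta_fac_sub_norm_le.
  - rewrite -mulrA ler_wpM2l ?addr_ge0 // ler_pM ?geometric_sum_le //.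
    + by apply: prodr_ge0 => j _; rewrite addr_ge0 ?mulr_ge0 ?exprn_ge0.
    + by apply: sumr_ge0 => j _; rewrite exprn_ge0.
have dc : d @ x --> (0 : C R) := @dist_inv_cvg0 _ _ x0.
apply: (continuous_of_modulus x0 _ dc lip).
  by rewrite mulr_gt0 // invr_gt0 subr_gt0.
by move=> y; rewrite addr_ge0.
Qed.

(** * Dominated convergence for sums over exhausting families *)

(** F is chosen with its sum within e of the supremum of all finite sums; a disjoint s adjoined to F
    cannot exceed that supremum. *)
Lemma summable_tail_real (R : realType) (I : eqType) (w : I -> R) (W : R) :
  (forall s, uniq s -> \sum_(i <- s) w i <= W) ->
  forall e, 0 < e -> exists2 F : seq I, uniq F &
    forall s, uniq s -> {in s, forall i, i \notin F} -> \sum_(i <- s) w i <= e.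
Proof.
move=> wW e e0.
pose E := [set x : R | exists2 s : seq I, uniq s & x = \sum_(i <- s) w i].
have supE : has_sup E.
  split; first by exists (\sum_(i <- [::]) w i), [::].
  by exists W => _ [s us ->]; exact: wW.
have [_ [F uF ->] hF] := sup_adherent e0 supE.
exists F => // s us sF.
have : \sum_(i <- F ++ s) w i <= sup E.
  apply: ub_le_sup; first by case: supE.
  exists (F ++ s) => //; rewrite cat_uniq uF us andbT /=.
  by apply/hasPn => i /sF.
rewrite big_cat /= => h.
rewrite -(lerD2l (\sum_(i <- F) w i)); apply: le_trans h _.
by rewrite -lerBlDr ltW.
Qed.

Lemma summable_tail (R : realType) (I : eqType) (w : I -> C R) (W : C R) :
  (forall i, 0 <= w i) ->
  (forall s, uniq s -> \sum_(i <- s) w i <= W) ->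
  forall e, 0 < e -> exists2 F : seq I, uniq F &
    forall s, uniq s -> {in s, forall i, i \notin F} -> \sum_(i <- s) w i <= e.
Proof.
move=> w0 wW e e0.
have sumE s : \sum_(i <- s) w i = rc (\sum_(i <- s) complex.Re (w i)).
  by rewrite rmorph_sum; apply: eq_bigr => i _; exact: ge0_rc.
have W0 : 0 <= W by have := wW [::] isT; rewrite big_nil.
have [||F uF hF] := @summable_tail_real _ _ (fun i => complex.Re (w i))
    (complex.Re W) _ (complex.Re e).
- by move=> s us; rewrite -rc_le -sumE -ge0_rc // wW.
- by rewrite -rc_lt -ge0_rc // ltW.
by exists F => // s us sF; rewrite sumE (ge0_rc (ltW e0)) rc_le hF.
Qed.

Lemma big_seq_split (V : nmodType) (I : eqType) (s F : seq I) (f : I -> V) :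
  uniq s -> uniq F -> {subset F <= s} ->
  \sum_(i <- s) f i = \sum_(i <- F) f i + \sum_(i <- s | i \notin F) f i.
Proof.
move=> us uF Fs; rewrite (bigID (mem F)) /=; congr (_ + _).
rewrite -big_filter; apply: perm_big; apply: uniq_perm => // [|i].
  exact: filter_uniq.
by rewrite mem_filter; apply/andP/idP => [[]//|iF]; split => //; exact: Fs.
Qed.

Lemma cvg_sum_seq (K : numFieldType) (I : Type) (F : seq I)
    (g : nat -> I -> K) (h : I -> K) :
  (forall i, g ^~ i @ \oo --> h i) ->
  (fun N => \sum_(i <- F) g N i) @ \oo --> \sum_(i <- F) h i.
Proof.
move=> gh; elim: F => [|i F IH].
  by rewrite big_nil; under eq_fun do rewrite big_nil; exact: cvg_cst.
by rewrite big_cons; under eq_fun do rewrite big_cons; exact: cvgD (gh i) IH.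
Qed.

Lemma near_subset_seq (I : eqType) (F : seq I) (T : nat -> seq I) :
  (forall i, \forall N \near \oo, i \in T N) ->
  \forall N \near \oo, {subset F <= T N}.
Proof.
move=> eT; elim: F => [|i F IH]; first by apply: nearW => N j.
near=> N => j; rewrite inE => /orP[/eqP->|].
  by near: N; exact: eT.
by move: j; near: N; exact: IH.
Unshelve. all: by end_near.
Qed.

(** Dominated convergence between two different exhaustions of I, stated as a difference so that no
    infinite sum is formed. Off a finite F both sums are at most e/3; on F convergence is
    termwise. *)
Lemma tannery (R : realType) (I : eqType) (w : I -> C R) (W : C R)
    (T T' : nat -> seq I) (g : nat -> I -> C R) (h : I -> C R) :
  (forall i, 0 <= w i) -> (forall s, uniq s -> \sum_(i <- s) w i <= W) ->
  (forall N, uniq (T N)) -> (forall N, uniq (T' N)) ->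
  (forall i, \forall N \near \oo, i \in T N) ->
  (forall i, \forall N \near \oo, i \in T' N) ->
  (forall N i, i \in T N -> `|g N i| <= w i) ->
  (forall i, `|h i| <= w i) -> (forall i, g ^~ i @ \oo --> h i) ->
  (fun N => \sum_(i <- T N) g N i - \sum_(i <- T' N) h i) @ \oo --> (0 : C R).
Proof.
move=> w0 wW uT uT' eT eT' gw hw gh; apply/cvgrPdist_le => e e0.
have e3 : 0 < e / 3 by rewrite divr_gt0.
have [F uF hF] := summable_tail w0 wW e3.
have tail s (f : I -> C R) : uniq s -> {in s, forall i, `|f i| <= w i} ->
    `|\sum_(i <- s | i \notin F) f i| <= e / 3.
  move=> us fw; apply: le_trans (ler_norm_sum _ _ _) _.
  rewrite -big_filter;
  apply: (@le_trans _ _ (\sum_(i <- [seq i <- s | i \notin F]) w i)).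
    rewrite big_seq [leRHS]big_seq; apply: ler_sum => i.
    by rewrite mem_filter => /andP[_ /fw].
  apply: hF; first exact: filter_uniq.
  by move=> i; rewrite mem_filter => /andP[].
near=> N.
rewrite sub0r normrN.
rewrite (@big_seq_split _ _ (T N) F) //; last by near: N; exact: near_subset_seq.
rewrite (@big_seq_split _ _ (T' N) F) //; last by near: N; exact: near_subset_seq.
have -> (a b c d : C R) : a + b - (c + d) = (a - c) + (b - d) by ring.
have -> : e = e / 3 + (e / 3 + e / 3) by field.
apply: le_trans (ler_normD _ _) _; apply: lerD.
  rewrite distrC; near: N.
  by have /cvgrPdist_le := cvg_sum_seq (F := F) gh; apply.
apply: le_trans (ler_normB _ _) _; apply: lerD; apply: tail => // i iT.
exact: gw.
Unshelve. all: by end_near.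
Qed.

(** * Convergence and bounds for the triple product coefficients *)

Lemma expr_neq1 (K : numFieldType) (p : K) j : `|p| < 1 -> p ^+ j.+1 != 1.
Proof.
move=> p1; apply/eqP => /(congr1 Num.norm); rewrite normrX normr1 => h.
have : `|p| ^+ j.+1 < 1 by rewrite exprn_ilt1.
by rewrite h ltxx.
Qed.

(** Since 1/(1 - u) = 1 + u/(1 - u), the reciprocals are again products of the kind handled by
    [prod1D_cvg]. *)
Lemma qpochV (F : fieldType) (p : F) n : (forall j, p ^+ j.+1 != 1) ->
  (qpoch p n)^-1 = \prod_(j < n) (1 + p ^+ j.+1 / (1 - p ^+ j.+1)).
Proof.
move=> hp; rewrite /qpoch -prodfV; apply: eq_bigr => j _.
have : 1 - p ^+ j.+1 != 0 by rewrite subr_eq0 eq_sym hp.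
by move: (p ^+ j.+1) => u hu; field.
Qed.

Lemma expS_norm_le (K : numFieldType) (p : K) j : `|p| < 1 ->
  `|- p ^+ j.+1| <= 1 * `|p| ^+ j.
Proof.
by move=> p1; rewrite normrN normrX exprS ler_wpM2r ?exprn_ge0 // ltW.
Qed.

Lemma expS_ratio_norm_le (K : numFieldType) (p : K) j : `|p| < 1 ->
  `|p ^+ j.+1 / (1 - p ^+ j.+1)| <= (1 - `|p|)^-1 * `|p| ^+ j.
Proof.
move=> p1; have p1' : 0 < 1 - `|p| by rewrite subr_gt0.
rewrite normrM mulrC; apply: ler_pM => //; last first.
  by have := expS_norm_le j p1; rewrite normrN mul1r.
rewrite normfV lef_pV2 ?posrE //; last first.
  by rewrite normr_gt0 subr_eq0 eq_sym expr_neq1.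
apply: le_trans (lerB_dist _ _); rewrite normr1 lerD2l lerN2 normrX.
by rewrite exprS ler_piMr // exprn_ile1 // ltW.
Qed.

Lemma qpoch_cvg (R : realType) (p : C R) : `|p| < 1 -> cvgn (qpoch p).
Proof.
move=> p1; apply: (@prod1D_cvg _ (fun j => - p ^+ j.+1) 1 `|p|) => // j.
exact: expS_norm_le.
Qed.

Lemma qpochV_cvg (R : realType) (p : C R) :
  `|p| < 1 -> cvgn (fun n => (qpoch p n)^-1).
Proof.
move=> p1; have -> : (fun n => (qpoch p n)^-1)
    = (fun n => \prod_(j < n) (1 + p ^+ j.+1 / (1 - p ^+ j.+1))).
  by apply/funext => n; rewrite qpochV // => j; exact: expr_neq1.
apply: (@prod1D_cvg _ (fun j => p ^+ j.+1 / (1 - p ^+ j.+1)) (1 - `|p|)^-1 `|p|) => //.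
  by rewrite invr_ge0 subr_ge0 ltW.
by move=> j; exact: expS_ratio_norm_le.
Qed.

Lemma qpoch_bounded (R : realType) (p : C R) : `|p| < 1 ->
  exists2 B : C R, 0 < B &
    forall n, `|qpoch p n| <= B /\ `|(qpoch p n)^-1| <= B.
Proof.
move=> p1; have i0 : 0 <= (1 - `|p|)^-1 by rewrite invr_ge0 subr_ge0 ltW.
have [B1 B10 h1] := prod_geometric_bounded ler01 (normr_ge0 p) p1.
have [B2 B20 h2] := prod_geometric_bounded i0 (normr_ge0 p) p1.
exists (B1 + B2) => [|n]; first exact: addr_gt0.
split.
  apply: (@le_trans _ _ B1); last by rewrite lerDl ltW.
  apply: le_trans (h1 n).
  apply: (@prod1D_norm_le _ (fun j => - p ^+ j.+1)) => j; exact: expS_norm_le.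
apply: (@le_trans _ _ B2); last by rewrite lerDr ltW.
rewrite qpochV => [|j]; last exact: expr_neq1.
apply: le_trans (h2 n).
apply: (@prod1D_norm_le _ (fun j => p ^+ j.+1 / (1 - p ^+ j.+1))) => j.
exact: expS_ratio_norm_le.
Qed.

Lemma jcoef_bounded (R : realType) (p : C R) : `|p| < 1 ->
  exists2 B : C R, 0 < B & forall N l, `|jcoef p N l| <= B.
Proof.
move=> p1; have [B B0 hB] := qpoch_bounded p1.
exists (B * (B * B)) => [|N l]; first by rewrite !mulr_gt0.
rewrite /jcoef /qbin invfM !normrM; apply: ler_pM => //; first exact: (hB _).1.
by apply: ler_pM => //; exact: (hB _).2.
Qed.

Lemma cvg_comp_infty (K : numFieldType) (u : nat -> K) (a : nat -> nat) (l : K) :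
  (forall M, \forall N \near \oo, (M <= a N)%N) -> u @ \oo --> l ->
  (fun N => u (a N)) @ \oo --> l.
Proof.
move=> ha ul; apply: (@cvg_comp _ _ _ a u \oo \oo) => //.
by apply/cvgnyPge.
Qed.

(** For fixed l all three indices tend to infinity. The limit is the same for every l, which later
    lets it leave the sum. *)
Lemma jcoef_cvg (R : realType) (p : C R) : `|p| < 1 ->
  exists k : C R, forall l, (fun N => jcoef p N l) @ \oo --> k.
Proof.
move=> p1; have /cvg_ex[Q hQ] := qpoch_cvg p1.
have /cvg_ex[Q' hQ'] := qpochV_cvg p1.
exists (Q * (Q' * Q')) => l; rewrite /jcoef /qbin.
under eq_fun do rewrite invfM.
have h1 : (fun N => qpoch p (2 * N)) @ \oo --> Q.
  by apply: cvg_comp_infty hQ => M; exists M => // N /=; lia.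
have h2 : (fun N => (qpoch p (absz (N%:Z + l)))^-1) @ \oo --> Q'.
  apply: (cvg_comp_infty (u := fun n => (qpoch p n)^-1)) hQ' => M.
  by exists (M + absz l)%N => // N /=; lia.
have h3 : (fun N => (qpoch p (2 * N - absz (N%:Z + l)))^-1) @ \oo --> Q'.
  apply: (cvg_comp_infty (u := fun n => (qpoch p n)^-1)) hQ' => M.
  by exists (M + absz l)%N => // N /=; lia.
exact: cvgM h1 (cvgM h2 h3).
Qed.

Lemma qpoch_real01 (K : numFieldType) (r : K) n : 0 <= r -> r < 1 ->
  0 < qpoch r n <= 1.
Proof.
move=> r0 r1; elim: n => [|n /andP[h0 h1]].
  by rewrite /qpoch big_ord0 ltr01 lexx.
have rn1 : r ^+ n.+1 < 1 by rewrite exprn_ilt1.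
rewrite qpochS mulr_gt0 ?subr_gt0 //=; apply: mulr_ile1 => //; first exact: ltW.
  by rewrite subr_ge0 ltW.
by rewrite lerBlDl lerDr exprn_ge0.
Qed.

(** The series of absolute values is thus itself a triple product series, at |p| and -|x|. *)
Lemma jterm_norm (K : numFieldType) (p x : K) l :
  `|jterm p x l| = jterm `|p| (- `|x|) l.
Proof.
rewrite /jterm normrM normrX opprK; congr (_ * _).
by case: l => n; rewrite ?NegzE -?exprnN -?exprnP ?normfV normrX normrN.
Qed.

(** At |p| and -|x| the finite triple product has nonnegative terms and a bounded left-hand side. As
    its coefficients are bounded below, the sum without them is bounded too. *)
Lemma jterm_bounded (R : realType) (p x : C R) : p != 0 -> `|p| < 1 -> x != 0 ->
  exists2 U : C R, 0 <= U & forall N, \sum_(l <- zint N) `|jterm p x l| <= U.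
Proof.
move=> p0 p1 x0; have np1 : `| `|p| | < 1 by rewrite normr_id.
have nx0 : - `|x| != 0 by rewrite oppr_eq0 normr_eq0.
have k0 : 0 <= `|- `|x| | + `|(- `|x|)^-1| + 1 by rewrite !addr_ge0.
have [W W0 hW] := prod_geometric_bounded k0 (normr_ge0 `|p|) np1.
have [B B0 hB] := qpoch_bounded np1.
exists (W * B) => [|N]; first by rewrite mulr_ge0 ?ltW.
have := @prod1D_norm_le _ (theta_fac `|p| (- `|x|)) _ _ N
  (fun j => theta_fac_norm_le j (ltW np1) nx0).
rewrite -theta_partE finite_triple_product ?normr_eq0 //; last first.
  by move=> j; exact: expr_neq1.
move=> /le_trans/(_ (hW N)) h.
rewrite -ler_pdivrMr //; apply: le_trans h.
rewrite mulr_suml.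
have q01 n := qpoch_real01 n (normr_ge0 p) p1.
have qB n : B^-1 <= qpoch `|p| n.
  have [_] := hB n; have /andP[q0 _] := q01 n.
  by rewrite normfV gtr0_norm // -(invrK B) lef_pV2 ?posrE ?invr_gt0 // invrK.
(* The two symbols in the denominator of [qbin] are at most 1, so [jcoef] is at least its
   numerator. *)
have jc l : B^-1 <= jcoef `|p| N l.
  rewrite /jcoef /qbin; apply: le_trans (qB (2 * N)%N) _.
  have /andP[q0 _] := q01 (2 * N)%N; rewrite ler_peMr ?(ltW q0) //.
  rewrite invf_ge1 //; last by rewrite mulr_gt0 // (andP (q01 _)).1.
  have /andP[? ?] := q01 (absz (N%:Z + l)).
  have /andP[? ?] := q01 (2 * N - absz (N%:Z + l)%R)%N.
  by apply: mulr_ile1 => //; exact: ltW.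
rewrite [leRHS]ger0_norm.
  by apply: ler_sum => l _; rewrite jterm_norm ler_wpM2l // -jterm_norm.
apply: sumr_ge0 => l _; rewrite mulr_ge0 //; first by rewrite -jterm_norm.
by apply: le_trans (jc l); rewrite invr_ge0 ltW.
Qed.

(** * Weierstrass' addition formula *)

Definition bdet (F : fieldType) (p x y : F) N : F :=
  bser1 p x N * bser0 p y N - bser0 p x N * bser1 p y N.

Definition zbox N : seq (int * int) := [seq (k, l) | k <- zint N, l <- zint N].

Lemma theta_part_mul (F : fieldType) (p z t : F) N
    (p0 : p != 0) (hp : forall j, p ^+ j.+1 != 1) (z0 : z != 0) (t0 : t != 0) :
  theta_part p z N * theta_part p t N
  = \sum_(kl <- zbox N) jterm p z kl.1 * jterm p t kl.2
                        * (jcoef p N kl.1 * jcoef p N kl.2).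
Proof.
rewrite !finite_triple_product // big_distrlr /= big_allpairs.
by apply: eq_bigr => k _; apply: eq_bigr => l _; rewrite /= mulrACA.
Qed.

Lemma zbox_uniq N : uniq (zbox N).
Proof.
by apply: allpairs_uniq (zint_uniq N) (zint_uniq N) _ => -[? ?] [? ?] _ _ /= [-> ->].
Qed.

Lemma mem_zbox N k l : ((k, l) \in zbox N) = (absz k <= N)%N && (absz l <= N)%N.
Proof.
rewrite -!mem_zint; apply/allpairsP/andP => [[[k' l'] /= [? ?] [-> ->]]//|[? ?]].
by exists (k, l).
Qed.

(** Every finite set of pairs lies in some box. *)
Lemma sum_uniq_le_zbox (K : numFieldType) (w : int * int -> K) (W : K) :
  (forall i, 0 <= w i) -> (forall N, \sum_(i <- zbox N) w i <= W) ->
  forall s, uniq s -> \sum_(i <- s) w i <= W.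
Proof.
move=> w0 wW s us.
pose M := \max_(i <- s) maxn (absz i.1) (absz i.2).
apply: le_trans (wW M); rewrite (@big_seq_split _ _ (zbox M) s) ?zbox_uniq //.
  by rewrite lerDl; apply: sumr_ge0.
move=> [k l] kls; rewrite mem_zbox -geq_max.
exact: (@leq_bigmax_seq _ s xpredT
  (fun i => maxn (absz i.1) (absz i.2)) (k, l) kls isT).
Qed.

(** Compares box sums with coefficients [jcoef] to diamond sums with their limit c. The constant k =
    c^2 is chosen before x and y, since the Plücker relation needs the same k in all its minors. *)
Lemma theta_pair_cvg (R : realType) (p : C R) : p != 0 -> `|p| < 1 ->
  exists k : C R, forall x y, x != 0 -> y != 0 ->
  (fun N => k * (x * bdet p x y N)) @ \oo --> theta p (x * y) * theta p (x / y).
Proof.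
move=> p0 p1; have hp j : p ^+ j.+1 != 1 by exact: expr_neq1.
have [c hc] := jcoef_cvg p1; have [B B0 hB] := jcoef_bounded p1.
exists (c * c) => x y x0 y0.
have z0 : x * y != 0 by rewrite mulf_neq0.
have t0 : x / y != 0 by rewrite mulf_neq0 ?invr_eq0.
pose h (kl : int * int) : C R :=
  jterm p (x * y) kl.1 * jterm p (x / y) kl.2 * (c * c).
pose g N (kl : int * int) : C R :=
  jterm p (x * y) kl.1 * jterm p (x / y) kl.2 * (jcoef p N kl.1 * jcoef p N kl.2).
pose w (kl : int * int) : C R :=
  `|jterm p (x * y) kl.1| * `|jterm p (x / y) kl.2| * (B * B).
have w0 kl : 0 <= w kl by rewrite /w !mulr_ge0 // ltW.
have [U1 U10 hU1] := jterm_bounded p0 p1 z0.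
have [U2 U20 hU2] := jterm_bounded p0 p1 t0.
have wU N : \sum_(kl <- zbox N) w kl <= U1 * U2 * (B * B).
  rewrite -mulr_suml ler_wpM2r ?mulr_ge0 ?(ltW B0) //.
  rewrite big_allpairs /=.
  have := ler_pM _ _ (hU1 N) (hU2 N); rewrite big_distrlr /=.
  by apply; apply: sumr_ge0.
(* The bound B passes to the limit c, so w dominates h as well as g. *)
have cB : `|c| <= B by exact: cvg_norm_le (hc 0) (fun N => hB N 0).
have hD N : \sum_(kl <- zdiamond N) h kl = c * c * (x * bdet p x y N).
  by rewrite /bdet -sum_zdiamond // mulrC mulr_suml.
have lim0 : (fun N => \sum_(kl <- zbox N) g N kl - \sum_(kl <- zdiamond N) h kl)
    @ \oo --> (0 : C R).
  apply: (tannery w0 (sum_uniq_le_zbox w0 wU)).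
  - exact: zbox_uniq.
  - exact: zdiamond_uniq.
  - move=> [k l]; exists (maxn (absz k) (absz l)) => // N /=.
    by rewrite mem_zbox -geq_max.
  - move=> [k l]; exists (maxn (absz k) (absz l)).+1 => // N /=.
    by rewrite gtn_max => /andP[? ?]; exact: mem_zdiamond.
  - move=> N kl _; rewrite /g /w normrM
       [X in X * _]normrM [X in _ * X]normrM ler_wpM2l ?mulr_ge0 //.
    by apply: ler_pM; rewrite ?normr_ge0 ?hB.
  - move=> kl; rewrite /h /w normrM
       [X in X * _]normrM [X in _ * X]normrM ler_wpM2l ?mulr_ge0 //.
    by apply: ler_pM; rewrite ?normr_ge0 ?hB.
  - move=> kl; apply: cvgM; first exact: cvg_cst.
    exact: cvgM (hc _) (hc _).
have hth : (fun N => theta_part p (x * y) N * theta_part p (x / y) N) @ \oo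
    --> theta p (x * y) * theta p (x / y).
  by apply: cvgM; exact: theta_part_cvg.
have hl := cvgB hth lim0; rewrite subr0 in hl.
(* Box sums of g are products of partial theta products; subtracting the vanishing difference leaves
   the diamond sum. *)
suff -> : (fun N => c * c * (x * bdet p x y N)) =
  (fun N => theta_part p (x * y) N * theta_part p (x / y) N
     - (\sum_(kl <- zbox N) g N kl - \sum_(kl <- zdiamond N) h kl)) by exact: hl.
apply/funext => N.
by rewrite theta_part_mul // hD opprB addrC subrK.
Qed.

(** Because 0^0 = 1, the factor at j = 0 is 1 - x and all others are 1. This serves the case p = 0,
    where the triple product would divide by p. *)
Lemma theta0 (R : realType) (x : C R) : theta 0 x = 1 - x.
Proof.
apply/cvg_lim => //.
apply: (@cvg_trans _ ((fun=> 1 - x) @ \oo)); last exact: cvg_cst.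
apply: near_eq_cvg; exists 1%N => // -[//|N] _ /=.
rewrite big_nat_recl // big1_seq => [|i _].
  by rewrite expr0 expr1 mul0r mulr1 subr0 !mulr1.
by rewrite [0 ^+ i.+2]exprS [0 ^+ i.+1]exprS !mul0r mulr0 !subr0 mulr1.
Qed.

Lemma theta1 (R : realType) (p : C R) : theta p 1 = 0.
Proof.
apply/cvg_lim => //.
apply: (@cvg_trans _ ((fun=> 0) @ \oo)); last exact: cvg_cst.
apply: near_eq_cvg; exists 1%N => // -[//|N] _ /=.
by rewrite big_nat_recl // expr0 mulr1 subrr !mul0r.
Qed.

(* The minors of the matrix with columns (bser1 z, bser0 z) satisfy the Plücker
   relation. *)
Lemma bdet_plucker (F : fieldType) (p k x y u v : F) N
    (d := fun a b => k * (a * bdet p a b N)) : y != 0 ->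
  d x y * d u v - d x v * d u y = u / y * (d y v * d x u).
Proof. by move=> y0; rewrite /d /bdet; field. Qed.

Lemma weierstrass_addition (R : realType) (p x y u v : C R) :
  `|p| < 1 -> x != 0 -> y != 0 -> u != 0 -> v != 0 ->
  theta p (x * y) * theta p (x / y) * (theta p (u * v) * theta p (u / v))
  - theta p (x * v) * theta p (x / v) * (theta p (u * y) * theta p (u / y))
  = u / y * (theta p (y * v) * theta p (y / v) * (theta p (x * u) * theta p (x / u))).
Proof.
move=> p1 x0 y0 u0 v0; have [->|p0] := eqVneq p 0.
  by rewrite !theta0; field; rewrite ?x0 ?y0 ?u0 ?v0.
have [k hk] := theta_pair_cvg p0 p1.
pose d a b N : C R := k * (a * bdet p a b N).
have l1 : (fun N => d x y N * d u v N - d x v N * d u y N) @ \oo -->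
  theta p (x * y) * theta p (x / y) * (theta p (u * v) * theta p (u / v))
  - theta p (x * v) * theta p (x / v) * (theta p (u * y) * theta p (u / y)).
  exact: cvgB (cvgM (hk x y x0 y0) (hk u v u0 v0))
              (cvgM (hk x v x0 v0) (hk u y u0 y0)).
have l2 : (fun N => u / y * (d y v N * d x u N)) @ \oo -->
  u / y * (theta p (y * v) * theta p (y / v) * (theta p (x * u) * theta p (x / u))).
  exact: cvgM (cvg_cst _) (cvgM (hk y v y0 v0) (hk x u x0 u0)).
have dE : (fun N => u / y * (d y v N * d x u N))
    = (fun N => d x y N * d u v N - d x v N * d u y N).
  by apply/funext => N; rewrite /d bdet_plucker.
rewrite dE in l2.
exact: cvg_unique l1 l2.
Qed.

(** * Elliptic numbers *)

(** Weierstrass' formula at x = sXY, y = s, u = sX, v = B/s with s^2 = a: every product and quotient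
    is then free of s, and u/y = X. *)
Lemma theta_addition (R : realType) (p a B X Y : C R) :
  `|p| < 1 -> a != 0 -> B != 0 -> X != 0 -> Y != 0 ->
  theta p X * theta p (a * X) * theta p (B * X * Y) * theta p (a * X * Y / B)
  + X * theta p B * theta p (a / B) * theta p Y * theta p (a * X ^+ 2 * Y)
  = theta p (X * Y) * theta p (a * X * Y) * theta p (B * X) * theta p (a * X / B).
Proof.
move=> p1 a0 B0 X0 Y0; pose s := sqrtC a.
have aE : a = s ^+ 2 by rewrite sqrtCK.
have s0 : s != 0 by rewrite sqrtC_eq0.
have := weierstrass_addition p1 (mulf_neq0 (mulf_neq0 s0 X0) Y0) s0
  (mulf_neq0 s0 X0) (mulf_neq0 B0 (invr_neq0 s0)).
have -> : s * X * Y * s = a * X * Y by rewrite aE; ring.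
have -> : s * X * Y / s = X * Y by field.
have -> : s * X * (B / s) = B * X by field.
have -> : s * X / (B / s) = a * X / B by rewrite aE; field; rewrite B0 s0.
have -> : s * X * Y * (B / s) = B * X * Y by field.
have -> : s * X * Y / (B / s) = a * X * Y / B by rewrite aE; field; rewrite B0 s0.
have -> : s * X * s = a * X by rewrite aE; ring.
have -> : s * X / s = X by field.
have -> : s * (B / s) = B by field.
have -> : s / (B / s) = a / B by rewrite aE; field; rewrite B0 s0.
have -> : s * X * Y * (s * X) = a * X ^+ 2 * Y by rewrite aE; ring.
have -> : s * X * Y / (s * X) = Y by field; rewrite X0 s0.
move: (theta p) => t /eqP; rewrite subr_eq => /eqP h.
rewrite [RHS](_ : _ = t (a * X * Y) * t (X * Y) * (t (B * X) * t (a * X / B))).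
  by rewrite h; ring.
by ring.
Qed.

Lemma ell_num_den_neq0 (R : realType) (a b q p : C R) (z : int) :
  (ell_num_den a b q p z != 0) =
  [&& theta p q != 0, theta p (a * q) != 0, theta p (b * q ^ (z + 1)) != 0 &
      theta p (a * q ^ (z - 1) / b) != 0].
Proof.
by rewrite /ell_num_den /thetas !big_cons big_nil mulr1 !mulf_eq0 !negb_or.
Qed.

Lemma ell_weight_den_neq0 (R : realType) (a b q p : C R) (k : nat) :
  (ell_weight_den a b q p k != 0) =
  [&& theta p (a * q) != 0, theta p (b * q ^+ k.+1) != 0,
      theta p (b * q ^+ k.+2) != 0, theta p (a * q ^ (k%:Z - 1) / b) != 0 &
      theta p (a * q ^+ k / b) != 0].
Proof.
by rewrite /ell_weight_den /thetas !big_cons big_nil mulr1 !mulf_eq0 !negb_or.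
Qed.

(** The field identity behind the recursion, with theta values as atoms named after their arguments:
    B = b q, X = q^n, Y = q^(m+1), so that [taXYB] stands for theta(aXY/B) and [taXb] for
    theta(aX/b). *)
Lemma ell_num_step (F : fieldType)
    (tX taX tBXY taXYB tB taB tY taXXY tXY taXY tBX taXB tq taq
     tbXqq taXb taqXX tbqq tab X : F) :
  tX * taX * tBXY * taXYB + X * tB * taB * tY * taXXY = tXY * taXY * tBX * taXB ->
  [&& taq != 0, tBX != 0, tbXqq != 0, taXB != 0 & taXb != 0] ->
  [&& tq != 0, taqXX != 0, tBXY != 0 & taXYB != 0] ->
  tX * (taX * (tbqq * tab)) / (tq * (taq * (tBX * taXB))) +
  taqXX * (tB * (tbqq * (taB * tab))) / (taq * (tBX * (tbXqq * (taXB * taXb)))) * X *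
  (tY * (taXXY * (tbXqq * taXb)) / (tq * (taqXX * (tBXY * taXYB)))) =
  tXY * (taXY * (tbqq * tab)) / (tq * (taq * (tBXY * taXYB))).
Proof.
move=> h /and5P[h1 h2 h3 h4 h5] /and4P[h6 h7 h8 h9].
have -> : tXY * (taXY * (tbqq * tab)) / (tq * (taq * (tBXY * taXYB))) =
    (tXY * taXY * tBX * taXB) * (tbqq * tab)
    / (tq * (taq * (tBXY * taXYB)) * (tBX * taXB)).
  by field; rewrite h1 h2 h4 h6 h8 h9.
by rewrite -h; field; rewrite h1 h2 h3 h4 h5 h6 h7 h8 h9.
Qed.

(** The recursion that makes the sum telescope: [theta_addition] at B = b q, X = q^n, Y =
    q^(m+1). *)
Lemma ell_numD (R : realType) (a b q p : C R) (n m : nat) :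
  `|p| < 1 -> a != 0 -> b != 0 -> q != 0 ->
  ell_weight_den a b q p n != 0 ->
  ell_num_den (a * q ^+ (2 * n)) (b * q ^+ n) q p m.+1%:Z != 0 ->
  ell_num a b q p n%:Z
  + ell_weight a b q p n * ell_num (a * q ^+ (2 * n)) (b * q ^+ n) q p m.+1%:Z
  = ell_num a b q p (n + m.+1)%:Z.
Proof.
move=> p1 a0 b0 q0.
rewrite ell_weight_den_neq0 ell_num_den_neq0.
have X0 : q ^+ n != 0 by rewrite expf_neq0.
have Y0 : q ^+ m.+1 != 0 by rewrite expf_neq0.
have := theta_addition p1 a0 (mulf_neq0 b0 q0) X0 Y0.
rewrite /ell_num /ell_weight /ell_num_den /ell_weight_den /thetas !big_cons !big_nil.
rewrite !mulr1 PoszD !expfzDr // !expr1z !exprN1 -!exprnP.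
rewrite [(2 * n)%N]mulnC exprM.
rewrite [q ^+ (_ * _).+1]exprS [q ^+ n.+2]exprS [q ^+ n.+1]exprS exprM.
move: (q ^+ n) (q ^+ m.+1) X0 Y0 => X Y X0 Y0.
(* Arguments are normalized so that equal theta values become syntactically equal before being
   generalized. *)
have -> : b * (q * X) = b * q * X by ring.
have -> : b * (X * q) = b * q * X by ring.
have -> : b * (X * Y * q) = b * q * X * Y by ring.
have -> : b * X * (Y * q) = b * q * X * Y by ring.
have -> : a * (X / q) / b = a * X / (b * q) by field; rewrite b0 q0.
have -> : a * (X * Y / q) / b = a * X * Y / (b * q) by field; rewrite b0 q0.
have -> : a * X ^+ 2 * (Y / q) / (b * X) = a * X * Y / (b * q).
  by field; rewrite b0 q0 X0.
have -> : a * X ^+ 2 / (b * X) = a * X / b by field; rewrite b0 X0.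
have -> : a / q / b = a / (b * q) by field; rewrite b0 q0.
have -> : b * (q * (q * X)) = b * X * q ^+ 2 by ring.
have -> : a * X ^+ 2 * q = a * (q * X ^+ 2) by ring.
have -> : a * (X * Y) = a * X * Y by ring.
move: (theta p X) (theta p (a * X)) (theta p (b * q * X * Y))
  (theta p (a * X * Y / (b * q))) (theta p (b * q)) (theta p (a / (b * q)))
  (theta p Y) (theta p (a * X ^+ 2 * Y)) (theta p (X * Y)) (theta p (a * X * Y))
  (theta p (b * q * X)) (theta p (a * X / (b * q))) (theta p q) (theta p (a * q))
  (theta p (b * X * q ^+ 2)) (theta p (a * X / b)) (theta p (a * (q * X ^+ 2)))
  (theta p (b * q ^+ 2)) (theta p (a / b)).
intros; apply: (@ell_num_step (C R)); eassumption.
Qed.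

(** * Limits of elliptic numbers, the telescoping sum and removable singularities *)

Lemma theta_continuous_comp (R : realType) (p : C R) (T : Type)
    (F : set_system T) (FF : Filter F) (f : T -> C R) (x : C R) :
  `|p| < 1 -> x != 0 -> f @ F --> x -> (fun t => theta p (f t)) @ F --> theta p x.
Proof. by move=> p1 x0 fx; apply: cvg_comp fx _; exact: theta_continuous. Qed.

Lemma cvg_expz (K : numFieldType) (T : Type) (F : set_system T) (FF : Filter F)
    (f : T -> K) (x : K) (z : int) :
  x != 0 -> f @ F --> x -> (fun t => f t ^ z) @ F --> x ^ z.
Proof.
have cvg_exprn k (g : T -> K) (y : K) :
    g @ F --> y -> (fun t => g t ^+ k) @ F --> y ^+ k.
  move=> gy; elim: k => [|k IH]; first exact: cvg_cst.
  rewrite exprS; under eq_fun do rewrite exprS; exact: cvgM gy IH.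
move=> x0 fx; case: z => k; first exact: cvg_exprn.
by apply: (cvgV (expf_neq0 k.+1 x0)); exact: cvg_exprn.
Qed.

Lemma cvg_prod_seq (K : numFieldType) (T : Type) (F : set_system T) (FF : Filter F)
    (I : eqType) (s : seq I) (g : T -> I -> K) (h : I -> K) :
  {in s, forall i, g ^~ i @ F --> h i} ->
  (fun t => \prod_(i <- s) g t i) @ F --> \prod_(i <- s) h i.
Proof.
elim: s => [|i s IH] hs.
  by rewrite big_nil; under eq_fun do rewrite big_nil; exact: cvg_cst.
rewrite big_cons; under eq_fun do rewrite big_cons.
apply: cvgM; first by apply: hs; rewrite mem_head.
by apply: IH => j js; apply: hs; rewrite inE js orbT.
Qed.

Lemma ell_num0 (R : realType) (a b q p : C R) : ell_num a b q p 0 = 0.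
Proof. by rewrite /ell_num /thetas !big_cons expr0z theta1 !mul0r. Qed.

(** The index k = n suffices. For j = m + 1, the factor theta(aq) comes from the weight and the
    other three from the shifted elliptic number, where the powers of q recombine. *)
Lemma lhs_dom_rhs_dom (R : realType) (p a b q : C R) n m :
  lhs_dom p n m a b q -> rhs_dom p n m a b q.
Proof.
move=> [a0 b0 q0 hd]; have [hW hM hj] := hd n (leqnn n).
split=> // j /andP[j1]; rewrite leq_eqVlt => /orP[/eqP->|]; last first.
  by rewrite ltnS => jm; apply: hj; rewrite j1.
move: hW hM; rewrite ell_weight_den_neq0 !ell_num_den_neq0.
move=> /and5P[h1 _ _ _ _] /and4P[h2 _ h3 h4]; rewrite h1 h2 /=.
have -> : b * q ^ ((n + m.+1)%:Z + 1) = b * q ^+ n * q ^ (m.+1%:Z + 1).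
  by rewrite -mulrA exprnP -expfzDr //; congr (_ * _ ^ _); lia.
rewrite h3.
suff -> : a * q ^ ((n + m.+1)%:Z - 1) / b
  = a * q ^+ (2 * n) * q ^ (m.+1%:Z - 1) / (b * q ^+ n) by [].
have -> : (n + m.+1)%:Z - 1 = n%:Z + m%:Z by lia.
have -> : m.+1%:Z - 1 = m%:Z by lia.
rewrite expfzDr // mulnC exprM -!exprnP.
by field; rewrite b0 expf_neq0.
Qed.

Lemma lhs_eq_rhs (R : realType) (p a b q : C R) n m : `|p| < 1 ->
  lhs_dom p n m a b q -> lhs p n m a b q = rhs p n m a b q.
Proof.
move=> p1; rewrite /lhs /rhs.
(* The recursion multiplied by [k+1]...[k+m]: the k-th summand is the difference of two consecutive
   products of m + 1 elliptic numbers. *)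
have step k : lhs_dom p k m a b q ->
    ell_num a b q p k%:Z * \prod_(1 <= j < m.+1) ell_num a b q p (k + j)%:Z
    + ell_weight a b q p k * ell_num (a * q ^+ (2 * k)) (b * q ^+ k) q p m.+1%:Z
      * \prod_(1 <= j < m.+1) ell_num a b q p (k + j)%:Z
    = \prod_(1 <= j < m.+2) ell_num a b q p (k + j)%:Z.
  move=> [a0 b0 q0 /(_ k (leqnn k))[hW hM _]].
  by rewrite -mulrDl ell_numD // [RHS]big_nat_recr //= mulrC.
elim: n => [|n IH] hd.
  (* As [0] = 0, the lower product vanishes at k = 0. *)
  by rewrite big_nat1 -(step 0 hd) ell_num0 mul0r add0r.
rewrite big_nat_recr //= -(step n.+1 hd); congr (_ + _).
rewrite IH; last first.
  by case: hd => a0 b0 q0 hd; split => // k kn; apply: hd; exact: leqW.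
(* With [n+1] split off, the right-hand side for n is the lower product of [step] at n + 1. *)
rewrite big_nat_recl // addn1; congr (_ * _).
by apply: eq_bigr => j _; rewrite addnS.
Qed.

(** All powers of q are integer powers here, so one limit statement covers them. *)
Lemma ell_numE (R : realType) (a b q p : C R) (z : int) :
  ell_num a b q p z =
  theta p (q ^ z) * theta p (a * q ^ z) * theta p (b * q ^ 2%:Z) * theta p (a / b)
  / (theta p q * theta p (a * q) * theta p (b * q ^ (z + 1))
     * theta p (a * q ^ (z - 1) / b)).
Proof.
by rewrite /ell_num /ell_num_den /thetas !big_cons !big_nil !mulr1 !mulrA.
Qed.

Lemma ell_num_cvg (R : realType) (p : C R) (T : Type) (F : set_system T)
    (FF : Filter F) (fa fb fq : T -> C R) (a b q : C R) (z : int) :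
  `|p| < 1 -> a != 0 -> b != 0 -> q != 0 ->
  fa @ F --> a -> fb @ F --> b -> fq @ F --> q ->
  ell_num_den a b q p z != 0 ->
  (fun t => ell_num (fa t) (fb t) (fq t) p z) @ F --> ell_num a b q p z.
Proof.
move=> p1 a0 b0 q0 ha hb hq hden.
have tc f x : x != 0 -> f @ F --> x -> (fun t => theta p (f t)) @ F --> theta p x.
  exact: theta_continuous_comp.
have hz k : (fun t => fq t ^ k) @ F --> q ^ k by exact: cvg_expz.
have hqz k : q ^ k != 0 by exact: expfz_neq0.
have hV : (fun t => (fb t)^-1) @ F --> b^-1 by exact: (cvgV b0 hb).
have bV0 : b^-1 != 0 by rewrite invr_eq0.
have t1 : (fun t => theta p (fq t ^ z)) @ F --> theta p (q ^ z).
  exact: tc _ _ (hqz z) (hz z).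
have t2 : (fun t => theta p (fa t * fq t ^ z)) @ F --> theta p (a * q ^ z).
  exact: tc _ _ (mulf_neq0 a0 (hqz z)) (cvgM ha (hz z)).
have t3 : (fun t => theta p (fb t * fq t ^ 2%:Z)) @ F --> theta p (b * q ^ 2%:Z).
  exact: tc _ _ (mulf_neq0 b0 (hqz 2%:Z)) (cvgM hb (hz 2%:Z)).
have t4 : (fun t => theta p (fa t / fb t)) @ F --> theta p (a / b).
  exact: tc _ _ (mulf_neq0 a0 bV0) (cvgM ha hV).
have t6 : (fun t => theta p (fa t * fq t)) @ F --> theta p (a * q).
  exact: tc _ _ (mulf_neq0 a0 q0) (cvgM ha hq).
have t7 : (fun t => theta p (fb t * fq t ^ (z + 1))) @ F --> theta p (b * q ^ (z + 1)).
  exact: tc _ _ (mulf_neq0 b0 (hqz (z + 1))) (cvgM hb (hz (z + 1))).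
have t8 : (fun t => theta p (fa t * fq t ^ (z - 1) / fb t)) @ F
    --> theta p (a * q ^ (z - 1) / b).
  exact: tc _ _ (mulf_neq0 (mulf_neq0 a0 (hqz (z - 1))) bV0)
    (cvgM (cvgM ha (hz (z - 1))) hV).
have d0 : theta p q * theta p (a * q) * theta p (b * q ^ (z + 1))
     * theta p (a * q ^ (z - 1) / b) != 0.
  by move: hden; rewrite ell_num_den_neq0 => /and4P[h1 h2 h3 h4]; rewrite !mulf_neq0.
rewrite ell_numE; under eq_fun do rewrite ell_numE.
exact: cvgM (cvgM (cvgM (cvgM t1 t2) t3) t4)
  (cvgV d0 (cvgM (cvgM (cvgM (tc _ _ q0 hq) t6) t7) t8)).
Qed.

Lemma rhs_cvg (R : realType) (p a b q : C R) n m : `|p| < 1 ->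
  rhs_dom p n m a b q ->
  rhs p n m x.1.1 x.1.2 x.2 @[x --> nbhs (a, b, q)] --> rhs p n m a b q.
Proof.
move=> p1 [a0 b0 q0 hd].
have hab : (fun x : C R * C R * C R => x.1) @ nbhs (a, b, q) --> nbhs (a, b).
  exact: cvg_fst.
have ha : (fun x : C R * C R * C R => x.1.1) @ nbhs (a, b, q) --> a.
  exact: cvg_comp hab cvg_fst.
have hb : (fun x : C R * C R * C R => x.1.2) @ nbhs (a, b, q) --> b.
  exact: cvg_comp hab cvg_snd.
have hq : (fun x : C R * C R * C R => x.2) @ nbhs (a, b, q) --> q.
  exact: cvg_snd.
apply: (cvg_prod_seq _ (g := fun x j => ell_num x.1.1 x.1.2 x.2 p (n + j)%:Z)) => j.
rewrite mem_index_iota => hj; apply: ell_num_cvg => //.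
exact: hd.
Qed.

Theorem theorem5 (R : realType) (a b q p : C R) (n m : nat)
    (ha : a != 0) (hb : b != 0) (hq : q != 0) (hp : `|p| < 1)
    (hlhs : makes_sense (lhs_dom p n m) (lhs p n m) a b q)
    (hrhs : makes_sense (rhs_dom p n m) (rhs p n m) a b q) :
  value (lhs_dom p n m) (lhs p n m) a b q
  = value (rhs_dom p n m) (rhs p n m) a b q.
Proof.
rewrite /value; case: asboolP => [hl|nl].
  by have hr := lhs_dom_rhs_dom hl; rewrite asboolT // lhs_eq_rhs.
case: hlhs => // -[cl _].
pose L := [set x : C R * C R * C R | lhs_dom p n m x.1.1 x.1.2 x.2].
pose f (x : C R * C R * C R) := rhs p n m x.1.1 x.1.2 x.2.
(* The point lies in the closure of L, so the filter is proper and limits along it are unique. *)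
have PF : ProperFilter (within L (nbhs (a, b, q))) by exact: within_nbhs_proper.
apply: cvg_lim; first exact: norm_hausdorff.
(* On L both sides agree, so the limit of the right-hand side along L is what matters. *)
apply: (@cvg_trans _ (f x @[x --> within L (nbhs (a, b, q))])).
  move=> P; apply: (@filterS _ _ (nbhs_filter (a, b, q))) => x h Lx.
  by have := h Lx; rewrite /f /= lhs_eq_rhs.
case: asboolP => [hr|nr].
  apply: cvg_within_filter; exact: rhs_cvg.
(* Here the right-hand side is singular as well; its limit along its own domain restricts to the
   smaller set L. *)
case: hrhs => // -[_ cr]; apply: cvg_trans cr => P.
apply: (@filterS _ _ (nbhs_filter (a, b, q))) => x h Lx; exact: h (lhs_dom_rhs_dom Lx).
Qed.
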